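(* For all real numbers $a,b>0$ and $\nu\in[0,1]$, $$(1-\nu)a+\nu b \;\geq\; S\left(\left(\frac{b}{a}\right)^{r}\right)a^{1-\nu}b^{\nu},$$ where $r=\min\{\nu,1-\nu\}$ and $S(\cdot)$ is Specht's ratio.
   Context: Specht's ratio is the function $S:(0,\infty)\to\mathbb{R}$ defined by $$S(h)=\frac{h^{\frac{1}{h-1}}}{e\,\log\left(h^{\frac{1}{h-1}}\right)}\quad (h>0,\ h\neq 1),\qquad S(1)=1,$$ where $\log$ is the natural logarithm and $e$ is its base. *)

(* Defs.v *)
From Stdlib Require Import Reals.
Open Scope R_scope.

(* Specht's ratio on (0, oo).  Its values at h <= 0 are irrelevant: they only
   reflect the conventions of the total functions [Rpower] and [ln]. *)
Definition specht (h : R) : R :=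
  if Req_dec_T h 1 then 1
  else Rpower h (1 / (h - 1)) / (exp 1 * ln (Rpower h (1 / (h - 1)))).

(* Main.v *)
Require Import Defs.
From Stdlib Require Import Reals Lra.
From Coquelicot Require Import Coquelicot.
Open Scope R_scope.

(** Put [w = ln x / (x - 1)], so that [S(x) = exp (w - 1) / w].  For [x > 1]
    the bound [0 <= 1 - w <= (x - 1) / (x + 1)] (logarithmic mean between 1 and
    the arithmetic mean) and [exp (1 - w) >= 2 - w] give
    [S(x) <= 1 / (1 - (1 - w)^2) <= (x + 1/x) / 2]; this extends to all
    [x > 0] because [S(1/x) = S(x)].
    For [nu <= 1/2] and [x = (b/a)^nu], multiplying the right-hand side by
    [a^(1-nu) b^nu] yields [(a + a^(1-2nu) b^(2nu)) / 2], which Young's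
    inequality bounds by [(1 - nu) a + nu b].  The case [nu >= 1/2] follows by
    exchanging [a] and [b], because [x + 1/x] is invariant under inversion. *)

(** The derivative [1/t - 4/(t+1)^2] equals [(t-1)^2 / (t (t+1)^2)], which is nonnegative. Both
    terms vanish at 1, so starting from [x = 1] yields a lower bound on [ln y]. *)
Lemma ln_sub_homographic_mono (x y : R) :
  0 < x -> x < y ->
  ln x - 2 * (x - 1) / (x + 1) <= ln y - 2 * (y - 1) / (y + 1).
Proof.
  intros Hx Hxy.
  destruct (MVT_cor2 (fun t => ln t - 2 * (t - 1) / (t + 1))
              (fun t => (t - 1) ^ 2 / (t * (t + 1) ^ 2)) x y Hxy)
    as [c [Heq Hc]].
  - intros c Hc; apply is_derive_Reals; auto_derive.
    + repeat split; lra.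
    + field; lra.
  - assert (0 <= (c - 1) ^ 2 / (c * (c + 1) ^ 2)).
    { apply Rdiv_le_0_compat; [apply pow2_ge_0 |].
      apply Rmult_lt_0_compat; [lra | apply pow_lt; lra]. }
    cbv beta in Heq; nra.
Qed.

Lemma ln_div_sub1_bounds (x : R) :
  1 < x -> 2 / (x + 1) <= ln x / (x - 1) <= 1.
Proof.
  intros Hx; split.
  - apply (Rle_div_r _ _ (x - 1) ltac:(lra)).
    generalize (ln_sub_homographic_mono 1 x Rlt_0_1 Hx); rewrite ln_1.
    replace (2 / (x + 1) * (x - 1)) with (2 * (x - 1) / (x + 1))
      by (field; lra).
    lra.
  - apply (Rle_div_l _ _ (x - 1) ltac:(lra)).
    generalize (exp_ineq1_le (ln x)); rewrite exp_ln by lra; lra.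
Qed.

Lemma specht_neq1 (x : R) :
  x <> 1 -> specht x = exp (ln x / (x - 1) - 1) / (ln x / (x - 1)).
Proof.
  intros Hx1.
  unfold specht; destruct (Req_dec_T x 1) as [| _]; [contradiction |].
  unfold Rpower; rewrite ln_exp.
  replace (1 / (x - 1) * ln x) with (ln x / (x - 1)) by (field; lra).
  unfold Rminus at 3; rewrite exp_plus, exp_Ropp.
  unfold Rdiv; rewrite Rinv_mult; ring.
Qed.

(** Inversion turns [w = ln x / (x - 1)] into [x * w]. Since [x * w - w = ln x], the exponential
    gains a factor [x], which cancels the one in the denominator. *)
Lemma specht_inv (x : R) : 0 < x -> specht (/ x) = specht x.
Proof.
  intros Hx.
  destruct (Req_dec x 1) as [-> | Hx1]; [now rewrite Rinv_1 |].
  assert (Hln : ln x <> 0) by (apply ln_neq_0; lra).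
  assert (Hix : / x <> 1).
  { intros H; apply Hx1; rewrite <- (Rinv_inv x), H; apply Rinv_1. }
  rewrite !specht_neq1, ln_Rinv by assumption.
  replace (- ln x / (/ x - 1)) with (x * (ln x / (x - 1))) by (field; lra).
  replace (x * (ln x / (x - 1)) - 1) with (ln x + (ln x / (x - 1) - 1))
    by (field; lra).
  rewrite exp_plus, exp_ln by lra.
  field; lra.
Qed.

Lemma specht_le_mean_inv_gt1 (x : R) : 1 < x -> specht x <= (x + / x) / 2.
Proof.
  intros Hx.
  rewrite specht_neq1 by lra.
  destruct (ln_div_sub1_bounds x Hx) as [Hlo Hhi].
  set (w := ln x / (x - 1)) in *.
  assert (Hw : 2 <= w * (x + 1)) by (apply (Rle_div_l _ _ (x + 1) ltac:(lra)); lra).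
  assert (0 < w) by nra.
  (* Comparing reciprocals lets the tangent bound on [exp (1 - w)] act as a lower bound. *)
  replace (exp (w - 1) / w) with (/ (exp (1 - w) * w)).
  2: { rewrite Rinv_mult, <- exp_Ropp.
       replace (- (1 - w)) with (w - 1) by ring; reflexivity. }
  assert (He := exp_ineq1_le (1 - w)).
  replace ((x + / x) / 2) with (/ (2 * x / (x ^ 2 + 1))).
  2: { field; split; nra. }
  apply Rinv_le_contravar; [apply Rdiv_lt_0_compat; nra |].
  apply Rle_trans with ((2 - w) * w); [| nra].
  (* As [(2 - w) * w = 1 - (1 - w)^2], the goal amounts to [(1 - w)^2 * (x^2 + 1) <= (x - 1)^2];
     [Hsq] has the larger factor [(x + 1)^2] on the left. *)
  apply (Rle_div_l _ _ (x ^ 2 + 1) ltac:(nra)).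
  assert (Hsq : (1 - w) ^ 2 * (x + 1) ^ 2 <= (x - 1) ^ 2).
  { rewrite <- Rpow_mult_distr; apply pow_incr.
    assert (0 <= (1 - w) * (x + 1)) by (apply Rmult_le_pos; lra).
    lra. }
  assert (0 <= (1 - w) ^ 2 * x) by (apply Rmult_le_pos; [apply pow2_ge_0 | lra]).
  lra.
Qed.

Lemma specht_le_mean_inv (x : R) : 0 < x -> specht x <= (x + / x) / 2.
Proof.
  intros Hx.
  destruct (Rtotal_order x 1) as [H | [-> | H]].
  - assert (1 < / x) by (rewrite <- Rinv_1; apply Rinv_lt_contravar; lra).
    rewrite <- specht_inv by assumption.
    generalize (specht_le_mean_inv_gt1 (/ x) ltac:(assumption)).
    rewrite Rinv_inv; lra.
  - unfold specht; destruct (Req_dec_T 1 1); lra.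
  - now apply specht_le_mean_inv_gt1.
Qed.

(** The tangent to [exp] at the weighted mean [g] of the logarithms bounds [a] and [b] from below;
    in the weighted sum the linear terms cancel. *)
Lemma Rpower_young (a b t : R) :
  0 < a -> 0 < b -> 0 <= t <= 1 ->
  Rpower a (1 - t) * Rpower b t <= (1 - t) * a + t * b.
Proof.
  intros Ha Hb Ht.
  unfold Rpower; rewrite <- exp_plus.
  set (g := (1 - t) * ln a + t * ln b).
  assert (tangent : forall c, 0 < c -> exp g * (1 + (ln c - g)) <= c).
  { intros c Hc.
    rewrite <- (exp_ln c Hc) at 2.
    replace (ln c) with (g + (ln c - g)) at 2 by ring.
    rewrite exp_plus.
    apply Rmult_le_compat_l; [left; apply exp_pos | apply exp_ineq1_le]. }
  replace (exp g) with
    ((1 - t) * (exp g * (1 + (ln a - g))) + t * (exp g * (1 + (ln b - g))))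
    by (unfold g; ring).
  apply Rplus_le_compat; apply Rmult_le_compat_l; try lra; now apply tangent.
Qed.

Lemma young_mean_inv (a b nu : R) :
  0 < a -> 0 < b -> 0 <= nu <= 1 / 2 ->
  (Rpower (b / a) nu + / Rpower (b / a) nu) / 2
    * (Rpower a (1 - nu) * Rpower b nu) <= (1 - nu) * a + nu * b.
Proof.
  intros Ha Hb Hnu.
  (* The weight [2 * nu] is admissible because [nu <= 1/2]; averaging the resulting bound with [a]
     gives exactly [(1 - nu) * a + nu * b]. *)
  assert (Hy := Rpower_young a b (2 * nu) Ha Hb ltac:(lra)).
  assert (H1 : Rpower (b / a) nu * (Rpower a (1 - nu) * Rpower b nu)
               = Rpower a (1 - 2 * nu) * Rpower b (2 * nu)).
  { unfold Rpower; rewrite ln_div, <- !exp_plus by lra; f_equal; ring. }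
  assert (H2 : / Rpower (b / a) nu * (Rpower a (1 - nu) * Rpower b nu) = a).
  { unfold Rpower; rewrite ln_div, <- exp_Ropp, <- !exp_plus by lra.
    rewrite <- (exp_ln a Ha) at 3; f_equal; ring. }
  lra.
Qed.

Theorem theorem2p4 (a b nu : R) (ha : 0 < a) (hb : 0 < b)
    (hnu : 0 <= nu <= 1) :
  (1 - nu) * a + nu * b >=
  specht (Rpower (b / a) (Rmin nu (1 - nu)))
    * (Rpower a (1 - nu) * Rpower b nu).
Proof.
  apply Rle_ge.
  set (x := Rpower (b / a) (Rmin nu (1 - nu))).
  apply Rle_trans with ((x + / x) / 2 * (Rpower a (1 - nu) * Rpower b nu)).
  { apply Rmult_le_compat_r.
    - left; apply Rmult_lt_0_compat; apply exp_pos.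
    - apply specht_le_mean_inv, exp_pos. }
  unfold x; destruct (Rle_dec nu (1 / 2)) as [H | H].
  - rewrite Rmin_left by lra; apply young_mean_inv; lra.
  - rewrite Rmin_right by lra.
    assert (Hs := young_mean_inv b a (1 - nu) hb ha ltac:(lra)).
    replace (Rpower (a / b) (1 - nu)) with (/ Rpower (b / a) (1 - nu)) in Hs.
    2: { unfold Rpower; rewrite !ln_div, <- exp_Ropp by lra; f_equal; ring. }
    rewrite Rinv_inv in Hs.
    replace (1 - (1 - nu)) with nu in Hs by ring.
    lra.
Qed.
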